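(* Let $d\ge 2$ and let $G$ be a finite $d$-regular vertex-transitive bipartite graph. For $p\in[0,1]$ let $$\mathbb{G}_d(p)=\frac12\left(p\ln\left(\frac dp\right)+(d-p)\ln\left(1-\frac pd\right)-2(1-p)\ln(1-p)\right)$$ (with the convention $0\ln 0=0$, so that $p\ln(d/p)=0$ at $p=0$), and define the gap function $g(p)=\lambda_G(p)-\mathbb{G}_d(p)$ on $[0,1]$, where $\lambda_G$ is the entropy function of $G$. Then $g$ is a monotone increasing (non-decreasing) function with $g(0)=0$; in particular $g$ is non-negative. Furthermore, if $G$ contains a cycle of length $\ell$, then for all $p\in[0,1]$ $$g(p)\ge\int_0^p f(x)^{\ell}\,dx,\qquad\text{where } f(x)=\frac1{4d}\min\left(x,(1-x)^2\right).$$
   Context: Graphs are finite and simple; $v(G)$ is the number of vertices. A graph is vertex-transitive if for all vertices $u,v$ there is an automorphism $\phi$ of $G$ with $\phi(u)=v$. A cycle of length $\ell$ ($\ell\ge3$) is a sequence of $\ell$ distinct vertices, cyclically consecutive ones being adjacent. A $k$-matching is a set of $k$ pairwise vertex-disjoint edges and $m_k(G)$ is the number of $k$-matchings ($m_0(G)=1$). Entropy function. Let $G$ have $v(G)=2n$ vertices, $M(G,t)=\sum_{k=0}^n m_k(G)t^k$ for $t\ge0$, and $$p(G,t)=\frac{t\,M'(G,t)}{n\,M(G,t)},\qquad F(G,t)=\frac{\ln M(G,t)}{v(G)}-\frac12\,p(G,t)\ln t$$ (with $F(G,0)=0$, derivative taken in $t$). Let $p^*(G)=2\nu(G)/v(G)$,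 where $\nu(G)$ is the number of edges of a largest matching. The function $t\mapsto p(G,t)$ is a strictly increasing bijection $[0,\infty)\to[0,p^* )$; let $t(G,p)$ be its inverse. Define $\lambda_G(p)=F(G,t(G,p))$ for $0\le p<p^*$, $\lambda_G(p^* )=\lim_{p\nearrow p^*}\lambda_G(p)$ (this limit exists), and $\lambda_G(p)=0$ for $p>p^*$. For a $d$-regular bipartite graph with $d\ge1$ one has $p^*=1$, so $\lambda_G$ is given on all of $[0,1]$ by the first two cases. *)

(* Defs.v *)
From HB Require Import structures.
From mathcomp Require Import all_boot all_order all_algebra perm.

Set Implicit Arguments.
Unset Strict Implicit.
Unset Printing Implicit Defensive.

(* A graph is a boolean adjacency relation [e] on a finite vertex type [T]. *)
Section Graphs.
Variables (T : finType) (e : rel T).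

Definition simple_graph : Prop := symmetric e /\ irreflexive e.

Definition regular_graph (d : nat) : Prop :=
  forall x, #|[set y | e x y]| = d.

Definition bipartite_graph : Prop :=
  exists A : {set T}, forall x y, e x y -> (x \in A) != (y \in A).

Definition graph_automorphism (phi : {perm T}) : Prop :=
  forall x y, e (phi x) (phi y) = e x y.

Definition vertex_transitive : Prop :=
  forall u v, exists2 phi : {perm T}, graph_automorphism phi & phi u = v.

Definition has_cycle (l : nat) : Prop :=
  (3 <= l)%N /\ exists2 s : seq T, size s = l & ucycle e s.

Definition edge_set : {set {set T}} :=
  [set a | [exists x, exists y, e x y && (a == [set x; y])]].

Definition is_matching (M : {set {set T}}) : bool :=
  (M \subset edge_set) && trivIset M.

Definition matchings_count (k : nat) : nat :=
  #|[set M : {set {set T}} | is_matching M && (#|M| == k)]|.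

Definition matching_number : nat :=
  \max_(M : {set {set T}} | is_matching M) #|M|.

End Graphs.

From mathcomp Require Import all_classical all_reals all_analysis.
Import Order.TTheory GRing.Theory Num.Theory.
Import numFieldNormedType.Exports.

Local Open Scope ring_scope.

Section Entropy.
Variables (R : realType) (T : finType) (e : rel T).

(* Meant for an even number [#|T| = 2n] of vertices, with [n = #|T|./2]. *)
Definition matching_gf (t : R) : R :=
  \sum_(k < (#|T|./2).+1) (matchings_count e k)%:R * t ^+ k.

Definition dimer_density (t : R) : R :=
  t * derive1 matching_gf t / ((#|T|./2)%:R * matching_gf t).

Definition entropy_at (t : R) : R :=
  if t == 0 then 0
  else ln (matching_gf t) / #|T|%:R - 2^-1 * dimer_density t * ln t.

Definition max_density : R := (2 * matching_number e)%:R / #|T|%:R.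

(* The inverse of [dimer_density] on [0, +oo[, as the point [t >= 0] (unique
   when [0 <= p < max_density]) of density [p]. *)
Definition activity (p : R) : R :=
  xget 0 [set t | 0 <= t /\ dimer_density t = p]%classic.

Definition entropy (p : R) : R :=
  if p < max_density then entropy_at (activity p)
  else if p == max_density then
    lim (entropy_at (activity q) @[q --> max_density^'-])%classic
  else 0.

(* The convention 0 * ln 0 = 0 is automatic, since [ln 0 = 0]; and at p = 0
   the library has [d / 0 = 0]. *)
Definition Gd (d : nat) (p : R) : R :=
  2^-1 * (p * ln (d%:R / p) + (d%:R - p) * ln (1 - p / d%:R)
          - 2 * (1 - p) * ln (1 - p)).

Definition gap (d : nat) (p : R) : R := entropy p - Gd d p.

End Entropy.

Definition gap_rate (R : realType) (d : nat) (x : R) : R :=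
  (4 * d%:R)^-1 * Num.min x ((1 - x) ^+ 2).

(* Main.v *)
(* Let t be the activity of density p, and let Z(W) be the matching generating
   function of the subgraph induced on W. By vertex-transitivity
   1 - p = Z(V - u) / Z(V) for every vertex u. Write x_v = t Z(V - u - v) / Z(V)
   for the probability of the edge uv, so that the x_v sum to p over the
   neighbours v of u. The Heilmann-Lieb identity
     Z(V) Z(V - u - v) - Z(V - u) Z(V - v) = sum_P (+/-) t^|P| Z(V - P)^2
   over the paths P from u to v has only plus signs in a bipartite graph when
   u ~ v. Keeping the path uv gives x_v >= t (1 - p)^2 + x_v^2, hence
   d t (1 - p)^2 <= p (1 - p / d). As the derivative of the entropy is
   -(ln t) / 2 and that of G_d is
   -(ln t_d) / 2 with t_d = p (1 - p / d) / (d (1 - p)^2), the gap increases.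
   If u lies on a cycle C of length l, the path along C adds
   t^l (Z(V - C) / Z(V))^2 >= (t / (1 + d t)^2)^l >= f(p)^l
   to the bound for each of the two neighbours of u on C, and this makes the
   derivative of the gap at least f(p)^l. *)

Require Import Defs.
From mathcomp Require Import all_boot all_order all_algebra perm.
From mathcomp Require Import ring lra zify.
Set Implicit Arguments.
Unset Strict Implicit.
Unset Printing Implicit Defensive.
Import Order.TTheory GRing.Theory Num.Theory.

Local Open Scope ring_scope.

(** * Matching sums of induced subgraphs *)

Section MatchingSum.
Variables (R : realFieldType) (T : finType) (e : rel T).
Hypothesis e_simple : simple_graph e.

Let eC : symmetric e := e_simple.1.
Let eI : irreflexive e := e_simple.2.

(** Encoding induced subgraphs by the condition on [cover M] lets vertex deletion act on [W] and
    keeps the type [T] fixed. *)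
Definition matching_sum (W : {set T}) (t : R) : R :=
  \sum_(M : {set {set T}} | is_matching e M && (cover M \subset W)) t ^+ #|M|.

Lemma edge_setP (a : {set T}) :
  reflect (exists2 x, x \in a & exists2 y, e x y & a = [set x; y])
          (a \in edge_set e).
Proof.
rewrite inE; apply: (iffP existsP) => [[x /existsP[y /andP[exy /eqP->]]]|].
  by exists x; rewrite ?set21//; exists y.
by move=> [x _ [y exy ->]]; exists x; apply/existsP; exists y; rewrite exy eqxx.
Qed.

Lemma edge_setE u v : ([set u; v] \in edge_set e) = e u v.
Proof.
apply/edge_setP/idP => [[x _ [y exy /setP E]]|euv]; last first.
  by exists u; [rewrite set21 | exists v].
have xy : x != y by apply: contraTneq exy => ->; rewrite eI.
move: (E x) (E y) (E u) (E v); rewrite !inE !eqxx orbT/=.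
move=> /orP[]/eqP ? /orP[]/eqP ?; subst; move: xy; rewrite ?eqxx// => _ _ _.
by rewrite eC.
Qed.

Lemma edge_memE (a : {set T}) u : a \in edge_set e -> u \in a ->
  exists2 v, e u v & a = [set u; v].
Proof.
move=> /edge_setP[x _ [y exy ->]]; rewrite !inE => /orP[]/eqP->.
  by exists y.
by exists x; rewrite 1?eC// setUC.
Qed.

Lemma card_edge (a : {set T}) : a \in edge_set e -> #|a| = 2%N.
Proof.
move=> /edge_setP[x _ [y exy ->]]; rewrite cards2.
by case: eqP exy => // ->; rewrite eI.
Qed.

Lemma is_matching0 : is_matching e set0.
Proof. by rewrite /is_matching sub0set; apply/trivIsetP => A; rewrite inE. Qed.

Lemma matchingU1 M u v : e u v -> 
  is_matching e M -> u \notin cover M -> v \notin cover M ->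
  is_matching e ([set u; v] |: M).
Proof.
move=> euv /andP[sM /trivIsetP tM] uM vM.
apply/andP; split; first by rewrite subUset sub1set edge_setE euv.
have disj B : B \in M -> [disjoint [set u; v] & B].
  move=> BM; rewrite -setI_eq0; apply/eqP/setP => x; rewrite !inE.
  apply/andP => -[/orP[]/eqP-> xB]; [case/negP: uM|case/negP: vM];
    by apply/bigcupP; exists B.
apply/trivIsetP => A B; rewrite !inE => /orP[/eqP->|AM] /orP[/eqP->|BM] AB.
- by rewrite eqxx in AB.
- exact: disj.
- by rewrite disjoint_sym disj.
- exact: tM.
Qed.

Lemma sub_matching (M N : {set {set T}}) :
  N \subset M -> is_matching e M -> is_matching e N.
Proof.
move=> NM /andP[sM tM]; rewrite /is_matching (subset_trans NM sM).
exact: trivIsetS tM.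
Qed.

Lemma matching_cover_rem M u v : is_matching e M -> [set u; v] \in M ->
  cover (M :\ [set u; v]) = cover M :\ u :\ v.
Proof.
move=> /andP[_ /trivIsetP tM] uvM; apply/setP => x; rewrite !inE.
apply/bigcupP/idP => [[B]|].
  rewrite !inE => /andP[Buv BM] xB.
  have /setP/(_ x) : [set u; v] :&: B = set0.
    by apply/eqP; rewrite setI_eq0; apply: tM => //; rewrite eq_sym.
  rewrite !inE xB andbT => /negbT; rewrite negb_or => /andP[-> ->].
  by apply/bigcupP; exists B.
move=> /and3P[xv xu /bigcupP[B BM xB]]; exists B => //; rewrite !inE BM andbT.
by apply: contraTneq xB => ->; rewrite !inE negb_or xu.
Qed.

Lemma matching_uniq_mate M u v w : is_matching e M ->
  [set u; v] \in M -> [set u; w] \in M -> v = w.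
Proof.
move=> /andP[sM tM] vM wM.
have E : [set u; v] = [set u; w].
  rewrite -(def_pblock tM vM (set21 u v)).
  by rewrite -(def_pblock tM wM (set21 u w)).
have /subsetP/(_ _ vM) := sM; rewrite edge_setE => euv.
have : v \in [set u; w] by rewrite -E set22.
by rewrite !inE => /orP[]/eqP// vu; rewrite vu eI in euv.
Qed.

Lemma matching_sum_cover (W : {set T}) (t : R) u :
  \sum_(M | is_matching e M && (cover M \subset W) && (u \in cover M)) t ^+ #|M|
  = matching_sum W t - matching_sum (W :\ u) t.
Proof.
rewrite /matching_sum [X in X - _](bigID (fun M => u \in cover M))/=.
rewrite [X in _ + X - _](eq_bigl (fun M =>
  is_matching e M && (cover M \subset W :\ u))) ?addrK//.
by move=> M; rewrite subsetD1 andbA.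
Qed.

(** Removing the edge [uv] is a bijection onto the matchings inside [W - u - v], and costs one
    factor [t]. *)
Lemma matching_sum_edge (W : {set T}) (t : R) u v : u \in W -> v \in W -> e u v ->
  \sum_(M | is_matching e M && (cover M \subset W) && ([set u; v] \in M)) t ^+ #|M|
  = t * matching_sum (W :\ u :\ v) t.
Proof.
move=> uW vW euv; rewrite /matching_sum mulr_sumr.
have notin M' : cover M' \subset W :\ u :\ v ->
    (u \notin cover M') * (v \notin cover M') * ([set u; v] \notin M').
  rewrite subsetD1 subsetD1 => /andP[/andP[_ u'] v']; rewrite u' v'; split=> //.
  by apply: contra u' => M'uv; apply/bigcupP; exists [set u; v]; rewrite ?set21.
rewrite (reindex_onto (fun M => [set u; v] |: M) (fun M => M :\ [set u; v]))/=;
  last by move=> M /andP[_ ?]; rewrite setD1K.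
apply: eq_big => [M'|M' /andP[/andP[/andP[mM cM] _] /eqP E]]; last first.
  have uvM' : [set u; v] \notin M' by rewrite -E !inE eqxx.
  by rewrite cardsU1 uvM' exprS.
apply/idP/idP => [/andP[/andP[/andP[mM cM] uvM] /eqP E]|/andP[mM' cM']].
  rewrite -E matching_cover_rem// (sub_matching _ mM) ?subD1set//=.
  by rewrite !setSD.
have [[uM' vM'] nM'] := notin _ cM'.
rewrite matchingU1// setU11 setU1K// eqxx !andbT/=.
rewrite /cover bigcup_setU big_set1 !subUset !sub1set uW vW/=.
by apply: subset_trans cM' _; rewrite setDDl subsetDl.
Qed.

(** A matching either leaves [u] uncovered or joins it to exactly one neighbour [v]. *)
Lemma matching_sum_rec (W : {set T}) (t : R) u : u \in W ->
  matching_sum W t = matching_sum (W :\ u) t +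
    t * \sum_(v in W | e u v) matching_sum (W :\ u :\ v) t.
Proof.
move=> uW; apply/eqP; rewrite -subr_eq0 opprD addrA -matching_sum_cover subr_eq0.
rewrite mulr_sumr; under [X in _ == X]eq_bigr => v /andP[vW euv].
  rewrite -matching_sum_edge//; over.
rewrite (exchange_big_dep (fun M =>
  is_matching e M && (cover M \subset W) && (u \in cover M)))/=; last first.
  move=> v M /andP[vW euv] /andP[-> uvM].
  by apply/bigcupP; exists [set u; v]; rewrite ?set21.
apply/eqP/eq_bigr => M /andP[/andP[mM cM] /bigcupP[a aM ua]].
have [sM _] := andP mM.
have [v euv aE] := edge_memE (subsetP sM _ aM) ua.
rewrite (big_pred1 v)// => w; rewrite /= mM cM/=; apply/idP/eqP => [/andP[_ uwM]|->].
  by apply: (matching_uniq_mate mM uwM); rewrite -aE.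
rewrite euv -aE aM !andbT; apply: (subsetP cM); apply/bigcupP; exists a => //.
by rewrite aE set22.
Qed.

Lemma matching_sum_gt0 W (t : R) : 0 <= t -> 0 < matching_sum W t.
Proof.
move=> t0; rewrite /matching_sum (bigD1 set0)/=; last first.
  by rewrite is_matching0/= /cover big_set0 sub0set.
rewrite cards0 expr0 ltr_pwDl// sumr_ge0// => M _.
by rewrite exprn_ge0.
Qed.

Lemma matching_sumS (W V : {set T}) (t : R) : 0 <= t -> W \subset V ->
  matching_sum W t <= matching_sum V t.
Proof.
move=> t0 WV; rewrite /matching_sum [leRHS](bigID (fun M => cover M \subset W))/=.
rewrite [X in _ <= X + _](eq_bigl (fun M => is_matching e M && (cover M \subset W))).
  by rewrite lerDl sumr_ge0// => M _; rewrite exprn_ge0.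
move=> M; rewrite -andbA; congr andb; apply/andP/idP => [[]//|MW].
by rewrite (subset_trans MW WV).
Qed.

(** Double counting: [M] contributes to the difference at [u] exactly when it covers [u], and it
    covers [2 * #|M|] vertices. *)
Lemma sum_matching_sum_rem (t : R) :
  \sum_u (matching_sum [set: T] t - matching_sum [set~ u] t) =
  2 * \sum_(M | is_matching e M) #|M|%:R * t ^+ #|M|.
Proof.
have E u : matching_sum [set: T] t - matching_sum [set~ u] t =
    \sum_(M | is_matching e M && (u \in cover M)) t ^+ #|M|.
  rewrite -setTD -matching_sum_cover; apply: eq_bigl => M.
  by rewrite subsetT andbT.
under eq_bigr do rewrite E.
rewrite (exchange_big_dep (is_matching e))/=; last by move=> u M _ /andP[].
rewrite mulr_sumr; apply: eq_bigr => M mM.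
rewrite (eq_bigl (mem (cover M))) => [|u]; last by rewrite mM.
rewrite sumr_const mulrA -natrM mulr_natl; congr (_ *+ _).
have [sM /eqP <-] := andP mM.
rewrite (eq_bigr (fun=> 2%N)) => [|a aM].
  by rewrite sum_nat_const mulnC.
by rewrite card_edge// (subsetP sM).
Qed.

Lemma card_matching M : is_matching e M -> (2 * #|M| <= #|T|)%N.
Proof.
move=> mM; have [sM /eqP] := andP mM.
rewrite (eq_bigr (fun=> 2%N)) => [|a aM]; last by rewrite card_edge// (subsetP sM).
by rewrite sum_nat_const mulnC => ->; exact: max_card.
Qed.

Lemma sum_matching_card (F : nat -> R) :
  \sum_(M | is_matching e M) F #|M| =
  \sum_(k < (#|T|./2).+1) (matchings_count e k)%:R * F k.
Proof.
have le M : is_matching e M -> (#|M| < #|T|./2.+1)%N.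
  by move=> /card_matching; lia.
rewrite (partition_big
  (fun M : {set {set T}} => (inord #|M| : 'I_(#|T|./2).+1)) xpredT)//=.
apply: eq_bigr => k _.
rewrite (eq_bigr (fun=> F k)) => [|M /andP[mM /eqP <-]]; last first.
  by rewrite inordK// le.
rewrite sumr_const mulr_natl; congr (_ *+ _); apply: eq_card => M.
rewrite !inE unfold_in/=; case mM : (is_matching e M) => //=.
by rewrite -val_eqE/= inordK ?le.
Qed.

Lemma matching_sumTE (t : R) :
  matching_sum [set: T] t = \sum_(M | is_matching e M) t ^+ #|M|.
Proof. by apply: eq_bigl => M; rewrite subsetT andbT. Qed.

(** Induction on [#|W|] through [matching_sum_rec], which avoids transporting matchings along
    [phi]. *)
Lemma matching_sum_imset (phi : {perm T}) (W : {set T}) (t : R) :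
  graph_automorphism e phi -> matching_sum (phi @: W) t = matching_sum W t.
Proof.
move=> phiA; have [n] := ubnP #|W|; elim: n W => // n IH W; rewrite ltnS => Wn.
have [->|[u uW]] := set_0Vmem W; first by rewrite imset0.
have D V x : phi @: (V :\ x) = phi @: V :\ phi x.
  apply/setP => y; rewrite -(permKV phi y) !inE !mem_imset ?inE//;
    try exact: perm_inj.
  by rewrite (inj_eq perm_inj).
have cW : (#|W :\ u| < n)%N by move: Wn; rewrite (cardsD1 u W) uW.
rewrite (matching_sum_rec _ (imset_f phi uW)) (matching_sum_rec _ uW).
rewrite -D IH//; congr (_ + _ * _).
rewrite (reindex_inj (@perm_inj _ phi))/=; apply: eq_big => [v|v _].
  by rewrite phiA mem_imset//; exact: perm_inj.
by rewrite -D IH// (leq_trans _ cW)// ltnS subset_leq_card// subD1set.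
Qed.

End MatchingSum.

(** * Correlation of two vertices *)

Section Correlation.
Variables (R : realFieldType) (T : finType) (e : rel T) (A : {set T}) (t : R).
Hypothesis e_simple : simple_graph e.
Hypothesis e_bip : forall x y, e x y -> (x \in A) != (y \in A).
Hypothesis t_ge0 : 0 <= t.

Let eC : symmetric e := e_simple.1.
Let eI : irreflexive e := e_simple.2.
Local Notation Z W := (matching_sum e W t).

Definition correlation (W : {set T}) (u v : T) : R :=
  Z W * Z (W :\ u :\ v) - Z (W :\ u) * Z (W :\ v).

(* This is [- (-1) ^ |P|] for every path [P] from [u] to [v]. *)
Definition side_sign (u v : T) : R := (-1) ^+ ((u \in A) == (v \in A)).

Lemma setD1AC (W : {set T}) u v : W :\ u :\ v = W :\ v :\ u.
Proof. by rewrite !setDDl setUC. Qed.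

(** Expand [Z W] and [Z (W - v)] at [u]: the products [Z (W - u) * Z (W - u - v)] cancel, and the
    neighbour [w = v], present only in the first expansion, leaves the square. *)
Lemma correlation_rec (W : {set T}) u v : u \in W -> v \in W -> u != v ->
  correlation W u v = (if e u v then t * Z (W :\ u :\ v) ^+ 2 else 0)
    - t * \sum_(w in W :\ v | e u w) correlation (W :\ u) w v.
Proof.
move=> uW vW uv.
have uWv : u \in W :\ v by rewrite !inE uv.
rewrite /correlation sumrB -mulr_sumr -mulr_suml.
rewrite (matching_sum_rec e_simple _ uW) (matching_sum_rec e_simple _ uWv).
have -> : \sum_(w in W | e u w) Z (W :\ u :\ w) =
    (if e u v then Z (W :\ u :\ v) else 0) +
    \sum_(w in W :\ v | e u w) Z (W :\ u :\ w).
  rewrite big_mkcondr (bigD1 v vW)/=; congr (_ + _).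
  rewrite -big_mkcondr; apply: eq_bigl => w; rewrite !inE.
  by rewrite [X in X && e u w]andbC.
rewrite (setD1AC W v u).
have -> : \sum_(w in W :\ v | e u w) Z (W :\ u :\ v :\ w) =
    \sum_(w in W :\ v | e u w) Z (W :\ u :\ w :\ v).
  by apply: eq_bigr => w _; rewrite (setD1AC _ v).
by case: (e u v); ring.
Qed.

Lemma side_signC u w v : e u w -> side_sign w v = - side_sign u v.
Proof.
move=> /e_bip; rewrite /side_sign.
by case: (u \in A); case: (w \in A); case: (v \in A) => //= _; rewrite ?opprK.
Qed.

Lemma side_sign_edge u v : e u v -> side_sign u v = 1.
Proof. by move=> /e_bip /negbTE; rewrite /side_sign => ->. Qed.

(** Crossing an edge flips [side_sign], which absorbs the minus sign of [correlation_rec]; this is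
    how bipartiteness enters. *)
Lemma signed_correlation_rec (W : {set T}) u v : u \in W -> v \in W -> u != v ->
  side_sign u v * correlation W u v =
    (if e u v then t * Z (W :\ u :\ v) ^+ 2 else 0)
    + t * \sum_(w in W :\ v | e u w) (side_sign w v * correlation (W :\ u) w v).
Proof.
move=> uW vW uv; rewrite correlation_rec// mulrBr; congr (_ + _).
  by case: ifP => [euv|_]; rewrite ?mulr0// side_sign_edge// mul1r.
rewrite mulrCA -mulrN -mulNr; congr (_ * _); rewrite mulr_sumr.
by apply: eq_bigr => w /andP[_ euw]; rewrite (side_signC _ euw).
Qed.

Lemma signed_correlation_ge0 (W : {set T}) u v :
  u \in W -> v \in W -> u != v -> 0 <= side_sign u v * correlation W u v.
Proof.
have [n] := ubnP #|W|; elim: n W u v => // n IH W u v Wn uW vW uv.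
rewrite signed_correlation_rec// addr_ge0//.
  by case: ifP => // _; rewrite mulr_ge0// exprn_ge0// ltW// matching_sum_gt0.
rewrite mulr_ge0// sumr_ge0// => w /andP[]; rewrite !inE => /andP[wv wW] euw.
have uw : w != u by apply: contraTneq euw => ->; rewrite eI.
apply: IH; rewrite ?inE ?uw 1?[v == u]eq_sym ?uv//.
by move: Wn; rewrite (cardsD1 u W) uW.
Qed.

(* Iterating the recursion would give the Heilmann-Lieb identity: the signed
   correlation is the sum of [t ^ |P| * Z (W - P) ^ 2] over all self-avoiding
   paths [P] from [u] to [v]. Only the term of one path is kept. *)
Lemma signed_correlation_path (W : {set T}) u p :
  path e u p -> uniq (u :: p) -> p != [::] -> {subset u :: p <= W} ->
  t ^+ size p * Z (W :\: [set x in u :: p]) ^+ 2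
  <= side_sign u (last u p) * correlation W u (last u p).
Proof.
elim: p W u => // x p IH W u /= /andP[eux px] /andP[uxp uniqp] _ sW.
have uW : u \in W by rewrite sW ?mem_head.
have vW : last x p \in W by rewrite sW// inE mem_last orbT.
have uv : u != last x p by apply: contraNneq uxp => ->; rewrite mem_last.
rewrite signed_correlation_rec//.
have sumge w : (w \in W :\ last x p) && e u w ->
    0 <= side_sign w (last x p) * correlation (W :\ u) w (last x p).
  rewrite !inE => /andP[/andP[wv wW] euw].
  have uw : w != u by apply: contraTneq euw => ->; rewrite eI.
  by apply: signed_correlation_ge0; rewrite ?inE ?uw ?[last x p == u]eq_sym ?uv.
have [p0|p0] := eqVneq p [::].
  subst p; rewrite /= eux expr1 -[leLHS]addr0 lerD//; last first.
    by rewrite mulr_ge0// sumr_ge0.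
  by rewrite setDDl; have -> // : [set y in [:: u; x]] = [set u] :|: [set x]
    by apply/setP => y; rewrite !inE.
rewrite -[leLHS]add0r lerD//.
  by case: ifP => // _; rewrite mulr_ge0// exprn_ge0// ltW// matching_sum_gt0.
have xv : x != last x p.
  case: p {IH px sW vW uv uxp sumge} p0 uniqp => //= y p _ /andP[+ _].
  by apply: contraNneq => {1}->; rewrite mem_last.
have xW : x \in W by rewrite sW// !inE eqxx orbT.
(* Among the neighbours of [u] only the next vertex [x] of the path is kept; the other summands are
   nonnegative. *)
rewrite exprS -mulrA ler_wpM2l// (bigD1 x)/= ?inE ?xv ?xW//.
rewrite -[leLHS]addr0 lerD ?sumr_ge0//; last first.
  by move=> w /andP[+ _]; exact: sumge.
have -> : W :\: [set y in [:: u, x & p]] = (W :\ u) :\: [set y in x :: p].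
  by apply/setP => y; rewrite !inE; case: eqP; case: (y \in W); rewrite ?andbF.
apply: IH => // y yxp; rewrite !inE sW ?andbT; last by rewrite inE yxp orbT.
by apply: contraNneq uxp => <-.
Qed.

Lemma correlation_edge_ge u v : e u v ->
  t * Z ([set: T] :\ u :\ v) ^+ 2 <= correlation [set: T] u v.
Proof.
move=> euv; have uv : u != v by apply: contraTneq euv => ->; rewrite eI.
have := @signed_correlation_path [set: T] u [:: v].
rewrite /= euv side_sign_edge// expr1 mul1r inE andbT uv setDDl.
have -> : [set x in [:: u; v]] = [set u] :|: [set v].
  by apply/setP => y; rewrite !inE.
by apply.
Qed.

(* The two terms come from the edge [u -- last x p] and from the rest of the
   cycle, seen as a path from [u] to [last x p]. *)
Lemma correlation_cycle_ge u x p :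
  ucycle e [:: u, x & p] -> p != [::] ->
  t * Z ([set: T] :\ u :\ last x p) ^+ 2
  + t ^+ (size p).+1 * Z (~: [set y in [:: u, x & p]]) ^+ 2
  <= correlation [set: T] u (last x p).
Proof.
move=> /andP[]/=; rewrite rcons_path => /and3P[eux pxp].
rewrite eC => euv /andP[uxp uniqxp] p0.
have uv : u != last x p by apply: contraNneq uxp => ->; rewrite mem_last.
have := signed_correlation_rec (in_setT u) (in_setT (last x p)) uv.
rewrite euv side_sign_edge// mul1r => ->; rewrite lerD//.
have xv : x != last x p.
  case: p {pxp euv uv uxp} p0 uniqxp => //= y p _ /andP[+ _].
  by apply: contraNneq => {1}->; rewrite mem_last.
rewrite exprS -mulrA ler_wpM2l// (bigD1 x)/= ?inE ?xv//.
rewrite -[leLHS]addr0 lerD//.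
  rewrite (_ : ~: _ = ([set: T] :\ u) :\: [set y in x :: p]).
    apply: signed_correlation_path => // y yxp; rewrite !inE andbT.
    by apply: contraNneq uxp => <-.
  by apply/setP => y; rewrite !inE negb_or andbT andbC.
rewrite sumr_ge0// => w /andP[/andP[]]; rewrite !inE andbT => wv euw _.
have uw : w != u by apply: contraTneq euw => ->; rewrite eI.
by apply: signed_correlation_ge0; rewrite ?inE ?uw ?[last x p == u]eq_sym ?uv.
Qed.
End Correlation.

(** * Densities in vertex-transitive bipartite graphs *)

(** Weighted Cauchy-Schwarz, from the nonnegativity of the variance around the mean [S / W]. It
    serves both for the edge probabilities at a vertex and for the sizes of matchings. *)
Lemma sqr_weighted_sum_le (R : realFieldType) (I : finType) (P : pred I)
    (w F : I -> R) : (forall i, P i -> 0 <= w i) ->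
  (\sum_(i | P i) w i * F i) ^+ 2
  <= (\sum_(i | P i) w i) * \sum_(i | P i) w i * F i ^+ 2.
Proof.
move=> w0; set W := \sum_(i | P i) w i; set S := \sum_(i | P i) w i * F i.
have W0 : 0 <= W by exact: sumr_ge0.
have [WE|Wneq0] := eqVneq W 0.
  have S0 : S = 0.
    by rewrite /S big1// => i Pi; rewrite (psumr_eq0P w0 WE)// mul0r.
  by rewrite WE S0 mul0r expr0n.
have : 0 <= \sum_(i | P i) w i * (F i - S / W) ^+ 2.
  by rewrite sumr_ge0// => i Pi; rewrite mulr_ge0 ?w0 ?sqr_ge0.
have -> : \sum_(i | P i) w i * (F i - S / W) ^+ 2 =
    \sum_(i | P i) w i * F i ^+ 2 - S * (2 * (S / W)) + W * (S / W) ^+ 2.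
  rewrite /W /S !mulr_suml -/S -/W -sumrB -big_split/=.
  by apply: eq_bigr => i _; ring.
set Q := \sum_(i | P i) w i * F i ^+ 2 => h.
rewrite -subr_ge0 (_ : _ - _ = W * (Q - S * (2 * (S / W)) + W * (S / W) ^+ 2)).
  exact: mulr_ge0.
by field.
Qed.

(** With [s = d * t] and [m] the minimum, the claim is [m * (1 + s) ^ 2 <= 4 * s]. For [s <= 1] use
    [m <= p <= s] and [(1 + s) ^ 2 <= 4]; for [s > 1] use [s * m <= s * (1 - p) ^ 2 <= 1] and
    [(1 + s) ^ 2 <= 4 * s ^ 2]. *)
Lemma min_rate_le (R : realFieldType) (d t p : R) :
  1 <= d -> 0 <= t -> 0 <= p -> p < 1 -> (1 + d * t)^-1 <= 1 - p ->
  d * t * (1 - p) ^+ 2 <= p * (1 - p / d) ->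
  (4 * d)^-1 * Num.min p ((1 - p) ^+ 2) <= t / (1 + d * t) ^+ 2.
Proof.
move=> d1 t0 p0 p1; set s := d * t => hq hs.
have d0 : 0 < d by lra.
have s0 : 0 <= s by rewrite mulr_ge0// ltW.
rewrite (_ : t = d^-1 * s); last by rewrite mulKf// gt_eqF.
rewrite invfM [4^-1 * _]mulrC -!mulrA ler_wpM2l ?invr_ge0 ?(ltW d0)//.
rewrite mulrA -/s ler_pdivlMr ?exprn_gt0//; last by lra.
have ps : p <= s.
  have : 1 <= (1 - p) * (1 + s) by rewrite -ler_pdivrMr ?div1r//; lra.
  nra.
have psq : s * (1 - p) ^+ 2 <= 1.
  apply: le_trans hs _; rewrite mulr_ile1 ?subr_ge0//; try lra.
    by rewrite ler_pdivrMr// mul1r; lra.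
  by rewrite gerBl divr_ge0// ltW.
have mp : Num.min p ((1 - p) ^+ 2) <= p by rewrite ge_min lexx.
have mq : Num.min p ((1 - p) ^+ 2) <= (1 - p) ^+ 2 by rewrite ge_min lexx orbT.
have m0 : 0 <= Num.min p ((1 - p) ^+ 2) by rewrite le_min p0 sqr_ge0.
set m := Num.min _ _ in mp mq m0 *.
have [s1|s1] := leP s 1; first by nra.
have ms : s * m <= 1 by nra.
nra.
Qed.

(** Counting edges from both sides gives [d * #|A| = d * #|~: A|], so the two colour classes have
    equal size. *)
Lemma card_bipartite_regular (T : finType) (e : rel T) (d : nat) :
  (0 < d)%N -> simple_graph e -> regular_graph e d -> bipartite_graph e ->
  #|T| = (#|T|./2).*2.
Proof.
move=> d_gt0 [eC _] e_reg [A eA].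
have deg x : (\sum_y e x y = d)%N.
  rewrite -(e_reg x) -sum1_card [RHS]big_mkcond/=.
  by apply: eq_bigr => y _; rewrite inE; case: (e x y).
have : (\sum_(x in A) \sum_y e x y = \sum_(x in ~: A) \sum_y e x y)%N.
  have dep (B : {set T}) : (forall x y, e x y -> (x \in B) != (y \in B)) ->
      (\sum_(x in B) \sum_y e x y = \sum_(x in B) \sum_(y in ~: B) e x y)%N.
    move=> eB; apply: eq_bigr => x xB; rewrite [RHS]big_mkcond/=.
    apply: eq_bigr => y _; rewrite inE; case: ifP => // /negbFE yB.
    by apply/eqP; rewrite eqb0; apply/negP => /eB; rewrite xB yB.
  rewrite (dep A)// (dep (~: A)) ?setCK; last first.
    by move=> x y /eA; rewrite !inE; case: (x \in A); case: (y \in A).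
  rewrite exchange_big; apply: eq_bigr => x _; apply: eq_bigr => y _.
  by rewrite eC.
rewrite (eq_bigr (fun=> d))// [RHS](eq_bigr (fun=> d))// !sum_nat_const => /eqP.
rewrite eqn_pmul2r// => /eqP cA; rewrite -(cardsC A) -cA; lia.
Qed.

Section VertexTransitive.
Variables (R : realFieldType) (T : finType) (e : rel T) (d : nat) (t : R).
Hypothesis d_gt0 : (0 < d)%N.
Hypothesis e_simple : simple_graph e.
Hypothesis e_reg : regular_graph e d.
Hypothesis t_ge0 : 0 <= t.

Let eC : symmetric e := e_simple.1.
Let eI : irreflexive e := e_simple.2.
Local Notation Z W := (matching_sum e W t).

Lemma matching_sum_le_rem (W : {set T}) u : Z W <= (1 + d%:R * t) * Z (W :\ u).
Proof.
have Z0 := matching_sum_gt0 e (W :\ u) t_ge0.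
have [uW|uW] := boolP (u \in W); last first.
  have -> : W :\ u = W by apply/setDidPl; rewrite disjoint_sym disjoints1.
  rewrite ler_peMl ?lerDl ?mulr_ge0//.
  exact/ltW/matching_sum_gt0.
rewrite (matching_sum_rec e_simple _ uW) mulrDl mul1r lerD2l mulrAC -mulrA [leLHS]mulrC.
rewrite mulrA ler_wpM2r//.
apply: (@le_trans _ _ (\sum_(v in W | e u v) Z (W :\ u))).
  by apply: ler_sum => v _; rewrite matching_sumS ?subD1set.
rewrite sumr_const -[_ *+ _]mulr_natl ler_wpM2r ?(ltW Z0)// ler_nat.
by rewrite -(e_reg u); apply/subset_leq_card/subsetP => x; rewrite !inE => /andP[].
Qed.

Lemma matching_sum_le_seq (W : {set T}) (s : seq T) :
  Z W <= (1 + d%:R * t) ^+ size s * Z (W :\: [set x in s]).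
Proof.
have dt0 : 0 <= 1 + d%:R * t by rewrite addr_ge0// mulr_ge0.
elim: s W => [|x s IH] W; first by rewrite expr0 mul1r set_nil setD0.
rewrite set_cons -setDDl exprS -mulrA; apply: le_trans (matching_sum_le_rem W x) _.
by rewrite ler_wpM2l.
Qed.

Hypothesis e_vt : vertex_transitive e.

Lemma matching_sum_vertexC u v : Z [set~ u] = Z [set~ v].
Proof.
have [phi phiA <-] := e_vt u v.
rewrite -(matching_sum_imset e_simple [set~ u] t phiA); congr matching_sum.
apply/setP => y; rewrite -(permKV phi y) mem_imset ?inE ?(inj_eq perm_inj)//.
exact: perm_inj.
Qed.

(** By transitivity the differences [Z V - Z (V - u)] all agree, so the average size of a matching
    can be read off at a single vertex. *)
Lemma sum_card_matching_rem u :
  #|T|%:R * (Z [set: T] - Z [set~ u]) =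
  2 * \sum_(M | is_matching e M) #|M|%:R * t ^+ #|M|.
Proof.
rewrite -sum_matching_sum_rem// (eq_bigr (fun=> Z [set: T] - Z [set~ u])).
  by rewrite sumr_const mulr_natl.
by move=> v _; rewrite (matching_sum_vertexC u v).
Qed.

Variable A : {set T}.
Hypothesis e_bip : forall x y, e x y -> (x \in A) != (y \in A).

Section Density.
Variable u : T.
(** The probability that [u] is covered when [M] has weight [t ^ #|M|]; [dimer_density_vertex]
    identifies it with the dimer density. For a neighbour [v], [x v] is the probability of the edge
    [uv]. *)
Let p := 1 - Z [set~ u] / Z [set: T].
Let x v := t * Z ([set: T] :\ u :\ v) / Z [set: T].

Let Z0 : 0 < Z [set: T]. Proof. exact: matching_sum_gt0. Qed.

Lemma density_lt1 : p < 1.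
Proof. by rewrite gtrBl divr_gt0// matching_sum_gt0. Qed.

Lemma density_ge0 : 0 <= p.
Proof. by rewrite subr_ge0 ler_pdivrMr// mul1r matching_sumS// subsetT. Qed.

Lemma density_inv_le : (1 + d%:R * t)^-1 <= 1 - p.
Proof.
have dt0 : 0 < 1 + d%:R * t by rewrite ltr_pwDl// mulr_ge0.
rewrite subKr ler_pdivlMr// mulrC ler_pdivrMr// mulrC -setTD.
exact: matching_sum_le_rem.
Qed.

Lemma sum_edge_density : \sum_(v in [set v | e u v]) x v = p.
Proof.
rewrite -mulr_suml -mulr_sumr.
have := matching_sum_rec e_simple t (in_setT u); rewrite setTD => E.
rewrite (_ : t * _ = Z [set: T] - Z [set~ u]); first by rewrite mulrBl divff ?gt_eqF.
rewrite {1}E addrC addKr; congr (_ * _).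
by apply: eq_bigl => v; rewrite !inE.
Qed.

(** Transitivity replaces [Z (V - u) ^ 2] by [Z (V - u) * Z (V - v)], which makes a correlation
    appear. *)
Lemma edge_densityB v : 
  x v - t * (1 - p) ^+ 2 = t * correlation e t [set: T] u v / Z [set: T] ^+ 2.
Proof.
rewrite /correlation !setTD -(matching_sum_vertexC u v) /x /p setTD.
by field; exact: lt0r_neq0.
Qed.

(* The fraction of covered vertices is [p] by vertex-transitivity, and
   [1 - p] is the probability that [u], or any [v], is uncovered; the summand
   [x v ^+ 2] coming from the edge [uv] itself is what turns the trivial bound
   [p] into [p * (1 - p / d)], by Cauchy-Schwarz over the neighbours of [u]. *)
Lemma density_ineq_excess (E : T -> R) :
  (forall v, e u v ->
     t * Z ([set: T] :\ u :\ v) ^+ 2 + E v <= correlation e t [set: T] u v) ->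
  d%:R * t * (1 - p) ^+ 2 <=
    p * (1 - p / d%:R) - \sum_(v in [set v | e u v]) t * E v / Z [set: T] ^+ 2.
Proof.
move=> h.
have d0 : 0 < d%:R :> R by rewrite ltr0n.
have S2 : p ^+ 2 / d%:R <= \sum_(v in [set v | e u v]) x v ^+ 2.
  have := @sqr_weighted_sum_le _ _ (mem [set v | e u v]) (fun=> 1) x (fun _ _ => ler01).
  under eq_bigr do rewrite mul1r.
  under [X in _ <= _ * X]eq_bigr do rewrite mul1r.
  by rewrite sum_edge_density sumr_const e_reg ler_pdivrMr// mulrC.
have : \sum_(v in [set v | e u v]) (x v ^+ 2 + t * E v / Z [set: T] ^+ 2) <=
    \sum_(v in [set v | e u v]) (x v - t * (1 - p) ^+ 2).
  apply: ler_sum => v; rewrite inE => euv; rewrite edge_densityB.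
  rewrite (_ : _ + _ = t * (t * Z ([set: T] :\ u :\ v) ^+ 2 + E v) / Z [set: T] ^+ 2);
    last by rewrite /x; field; exact: lt0r_neq0.
  by rewrite ler_wpM2r ?invr_ge0 ?exprn_ge0 ?(ltW Z0)// ler_wpM2l// h.
rewrite big_split sumrB/= sum_edge_density sumr_const e_reg -[_ *+ d]mulr_natl mulrA.
have -> : p * (1 - p / d%:R) = p - p ^+ 2 / d%:R by rewrite expr2; ring.
by move: S2; set S := \sum_(v in _) (t * E v / _); lra.
Qed.

Lemma density_ineq : d%:R * t * (1 - p) ^+ 2 <= p * (1 - p / d%:R).
Proof.
have := @density_ineq_excess (fun=> 0).
under eq_bigr do rewrite mulr0 mul0r.
rewrite big1// subr0; apply => v euv; rewrite addr0.
exact: correlation_edge_ge e_bip t_ge0 _ _ euv.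
Qed.

End Density.

(** Applies [density_ineq_excess] at the head [v] of the cycle, with an excess at its two neighbours
    on the cycle, whence the factor [2]. *)
Lemma cycle_density_ineq l u p : has_cycle e l ->
  p = 1 - Z [set~ u] / Z [set: T] ->
  d%:R * t * (1 - p) ^+ 2 <= p * (1 - p / d%:R)
    - 2 * ((4 * d%:R)^-1 * Num.min p ((1 - p) ^+ 2)) ^+ l.
Proof.
move=> [l3 [s sl cs]] p_def.
have Z0 : 0 < Z [set: T] by exact: matching_sum_gt0.
have dt0 : 0 < 1 + d%:R * t by rewrite ltr_pwDl// mulr_ge0.
case: s sl cs => [|v [|x [|y q]]] sl cs; try by rewrite -sl in l3.
have pE : p = 1 - Z [set~ v] / Z [set: T] by rewrite p_def (matching_sum_vertexC u v).
pose C : {set T} := [set z in [:: v, x, y & q]].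
(* The exponent [l - 1] is the length of the path along the cycle; the last factor [t] comes from
   [density_ineq_excess]. *)
pose E : R := t ^+ l.-1 * Z (~: C) ^+ 2.
(* The list [x' :: q'] may run around the cycle in either direction, so that both neighbours of [v]
   occur as the end [w]. *)
have key : forall w x' q', ucycle e [:: v, x' & q'] -> size q' = (size q).+1 ->
   [:: v, x' & q'] =i [:: v, x, y & q] -> last x' q' = w ->
   t * Z ([set: T] :\ v :\ w) ^+ 2 + E <= correlation e t [set: T] v w.
  move=> w x' q' cq' sq' eq' <-.
  have := @correlation_cycle_ge _ _ _ A t e_simple e_bip t_ge0 v x' q' cq'.
  rewrite /E -sl sq' (_ : [set z in _] = C) => [|]; last first.
    by apply/setP => z; rewrite !in_set eq'.
  by apply; case: q' {cq' eq'} sq'.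
have hlast := key _ _ _ cs erefl (fun=> erefl) erefl.
(* The first neighbour of [v] on the cycle is the last one of the reversed cycle. *)
have [revx [revq revE]] : exists x', exists q', rev [:: x, y & q] = x' :: q'.
  by case E' : (rev _) (size_rev [:: x, y & q]) => [|x' q']// _; exists x', q'.
have revlast : last revx revq = x.
  by rewrite -[LHS](last_cons x) -revE rev_cons last_rcons.
have revsize : size revq = (size q).+1.
  by have := size_rev [:: x, y & q]; rewrite revE => -[].
have hx : t * Z ([set: T] :\ v :\ x) ^+ 2 + E <= correlation e t [set: T] v x.
  apply: (key x revx revq) => //; last first.
    by move=> z; rewrite -revE !inE mem_rev !inE.
  rewrite -revE.
  have -> : v :: rev [:: x, y & q] = rotr 1 (rev [:: v, x, y & q]).
    by rewrite [rev (v :: _)]rev_cons rotr1_rcons.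
  case/andP: cs => cs us; apply/andP; split; last by rewrite rotr_uniq rev_uniq.
  rewrite rotr_cycle rev_cycle; rewrite (eq_cycle (e' := e))//.
pose E' w := if (w == x) || (w == last y q) then E else 0.
have := @density_ineq_excess v E'; rewrite -pE => /(_ _)/le_trans; apply.
  move=> w evw; rewrite /E'; case: ifP => [/orP[]/eqP ->//|_].
  by rewrite addr0; exact: correlation_edge_ge e_bip t_ge0 _ _ evw.
rewrite lerD2l lerN2.
have /andP[/= /andP[evx _] /and4P[_ xyq _ _]] := cs.
have evl : e v (last y q).
  by have /andP[+ _] := cs; rewrite /= rcons_path => /and4P[_ _ _]; rewrite eC.
(* The two neighbours differ since the cycle has at least three vertices, so both excess terms can
   be extracted. *)
have xl : last y q != x by apply: contraNneq xyq => <-; rewrite mem_last.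
rewrite (bigD1 x) ?inE//= (bigD1 (last y q)) ?inE ?evl//=.
rewrite /E' !eqxx orbT /= addrA -[leLHS]addr0 lerD//; last first.
  rewrite sumr_ge0// => w _; rewrite mulr_ge0 ?invr_ge0 ?exprn_ge0 ?(ltW Z0)//.
  rewrite mulr_ge0//; case: ifP => // _.
  by rewrite mulr_ge0// exprn_ge0// ltW// matching_sum_gt0.
rewrite -mulr2n -[leRHS]mulr_natl ler_wpM2l//.
(* Two estimates meet here: [f(p) <= t / (1 + d * t) ^ 2] by [min_rate_le], and
   [Z V <= (1 + d * t) ^ l * Z (V - C)] by deleting the cycle vertex by vertex. *)
apply: (@le_trans _ _ ((t / (1 + d%:R * t) ^+ 2) ^+ l)).
  apply: lerXn2r; rewrite ?nnegrE ?divr_ge0 ?exprn_ge0 ?(ltW dt0)//.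
    by rewrite mulr_ge0 ?invr_ge0 ?mulr_ge0// le_min pE density_ge0 ?sqr_ge0.
  apply: min_rate_le; rewrite ?ler1n// pE.
  - exact: density_ge0.
  - exact: density_lt1.
  - exact: density_inv_le.
  - exact: density_ineq.
have := matching_sum_le_seq [set: T] [:: v, x, y & q]; rewrite sl setTD -/C => hC.
rewrite expr_div_n ler_pdivrMr ?exprn_gt0// mulrAC ler_pdivlMr ?exprn_gt0//.
rewrite /E mulrA -exprS (ltn_predK l3) -mulrA ler_wpM2l ?exprn_ge0//.
rewrite mulrC -exprM mulnC exprM -exprMn lerXn2r ?nnegrE ?(ltW Z0)//.
by rewrite mulr_ge0 ?exprn_ge0 ?(ltW dt0)// ltW// matching_sum_gt0.
Qed.
End VertexTransitive.

(** * Dimer density and entropy as functions of the activity *)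

(* Imported only here, because classical sets shadow the notations for finite
   sets used above. *)
From mathcomp Require Import all_classical all_reals all_analysis.
Import numFieldNormedType.Exports.

Lemma is_derive_ln_comp (R : realType) (f : R -> R) (x df : R) :
  0 < f x -> is_derive x 1 f df -> is_derive x 1 (fun y => ln (f y)) (df / f x).
Proof.
move=> fx0 fdf; have h := is_derive1_ln fx0.
by have := is_derive1_comp h fdf; rewrite mulrC.
Qed.

Lemma is_derive_Gd (R : realType) (d : nat) (p : R) :
  (0 < d)%N -> 0 < p < 1 ->
  is_derive p 1 (@Gd R d)
    (2^-1 * (ln (d%:R / p) - ln (1 - p / d%:R) + 2 * ln (1 - p))).
Proof.
move=> d0 /andP[p0 p1].
have d0' : 1 <= d%:R :> R by rewrite ler1n.
have dp : 0 < d%:R / p by rewrite divr_gt0//; lra.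
have pd : 0 < 1 - p / d%:R by rewrite subr_gt0 ltr_pdivrMr; lra.
have p1' : 0 < 1 - p by lra.
have pn0 : p != 0 by lra.
have h1 : is_derive p 1 (fun q => d%:R / q) (- d%:R / p ^+ 2).
  have h := @is_deriveV R id p 1 1 pn0 (is_derive_id p 1).
  by apply: is_derive_eq; rewrite /= ?scaler0 ?addr0 /GRing.scale/=; field.
have h2 : is_derive p 1 (fun q => 1 - q / d%:R) (- d%:R^-1).
  apply: is_derive_eq; rewrite /= ?scaler0 /GRing.scale/=; field; lra.
have h3 : is_derive p 1 (fun q : R => 1 - q) (-1).
  by apply: is_derive_eq; rewrite /= /GRing.scale/=; ring.
have := @is_derive_ln_comp _ (fun q => d%:R / q) _ _ dp h1.
have := @is_derive_ln_comp _ (fun q => 1 - q / d%:R) _ _ pd h2.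
have := @is_derive_ln_comp _ (fun q => 1 - q) _ _ p1' h3.
rewrite /Gd => l1 l2 l3.
apply: is_derive_eq; rewrite /= /GRing.scale/=.
field; lra.
Qed.

Lemma mulX_deriv_poly (R : nzRingType) m (c : nat -> R) :
  'X * (\poly_(k < m) c k)^`() = \poly_(k < m) (k%:R * c k).
Proof.
apply/polyP => k; rewrite coefXM coef_deriv !coef_poly.
case: k => [|k] /=; first by rewrite mul0r if_same.
by case: ifP => _; rewrite ?mul0rn// mulr_natl.
Qed.

Section DimerDensity.
Variables (R : realType) (T : finType) (e : rel T).

Local Notation M := (@matching_gf R T e).
Local Notation rho := (@dimer_density R T e).
Local Notation n := (#|T|./2).
Let P : {poly R} := \poly_(k < n.+1) (matchings_count e k)%:R.

Lemma matching_gf_horner : M = horner P.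
Proof. by apply/funext => t; rewrite horner_poly. Qed.

Lemma dimer_density_horner (t : R) : rho t = ('X * P^`()).[t] / (n%:R * P.[t]).
Proof. by rewrite /dimer_density matching_gf_horner -derivE hornerM hornerX. Qed.

Lemma is_derive_matching_gf (t : R) : is_derive t 1 M (P^`().[t]).
Proof. by rewrite matching_gf_horner; exact: is_derive_poly. Qed.

Lemma matching_gf_ge1 (t : R) : 0 <= t -> 1 <= M t.
Proof.
move=> t0; rewrite /matching_gf big_ord_recl expr0 mulr1 -[leLHS]addr0 lerD//.
  rewrite ler1n card_gt0; apply/set0Pn; exists finset.set0.
  by rewrite inE is_matching0 cards0.
by rewrite sumr_ge0// => k _; rewrite mulr_ge0// exprn_ge0.
Qed.

Lemma matching_gf_gt0 (t : R) : 0 <= t -> 0 < M t.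
Proof. by move=> /matching_gf_ge1; exact: lt_le_trans. Qed.

Lemma dimer_density_nil (t : R) : n = 0%N -> rho t = 0.
Proof. by move=> n0; rewrite /dimer_density n0 mul0r invr0 mulr0. Qed.

(** Up to a positive factor the derivative is the variance of the size of a matching: multiplying
    its numerator by [t] gives the total weight times the second moment, minus the squared first
    moment. *)
Lemma is_derive_dimer_density (t : R) : 0 < t ->
  exists2 D, is_derive t 1 rho D & 0 <= D.
Proof.
move=> t0; have [n0|n0] := posnP n.
  exists 0 => //; rewrite (_ : rho = cst 0); first exact: is_derive_cst.
  by apply/funext => x; exact: dimer_density_nil.
pose Q := 'X * P^`().
have Pt : 0 < P.[t] by rewrite -matching_gf_horner matching_gf_gt0// ltW.
have nR : 0 < n%:R :> R by rewrite ltr0n.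
exists ((Q^`().[t] * P.[t] - Q.[t] * P^`().[t]) / (n%:R * P.[t] ^+ 2)).
  rewrite (_ : rho = fun x => Q.[x] / (n%:R * P.[x])); last first.
    by apply/funext => x; rewrite dimer_density_horner.
  have hn : n%:R * P.[t] != 0 by rewrite mulf_neq0// gt_eqF.
  have hP := is_derive_poly P t.
  have hQ := is_derive_poly Q t.
  have hnP : is_derive t 1 (fun x => n%:R * P.[x]) (n%:R * P^`().[t]).
    by apply: is_derive_eq; rewrite /= /GRing.scale/=; ring.
  have hV := @is_deriveV _ (fun x => n%:R * P.[x]) _ _ _ hn hnP.
  apply: is_derive_eq; rewrite /= /GRing.scale/=; field.
  by rewrite !gt_eqF.
rewrite divr_ge0 ?mulr_ge0 ?exprn_ge0 ?(ltW nR) ?(ltW Pt)//.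
rewrite -(pmulr_rge0 _ t0) mulrBr.
have -> : t * (Q^`().[t] * P.[t]) = ('X * Q^`()).[t] * P.[t].
  by rewrite hornerM hornerX mulrA.
have -> : t * (Q.[t] * P^`().[t]) = Q.[t] ^+ 2.
  by rewrite mulrCA -[t * _](_ : Q.[t] = _) ?expr2// hornerM hornerX.
rewrite subr_ge0 /Q mulX_deriv_poly mulX_deriv_poly !horner_poly mulrC.
have := @sqr_weighted_sum_le R _ xpredT
  (fun k : 'I_n.+1 => (matchings_count e k)%:R * t ^+ k) (fun k => k%:R).
rewrite (eq_bigr (fun k : 'I_n.+1 =>
  k%:R * (matchings_count e k)%:R * t ^+ k)); last first.
  by move=> k _; ring.
rewrite [X in _ <= _ * X](eq_bigr (fun k : 'I_n.+1 =>
  k%:R * (k%:R * (matchings_count e k)%:R) * t ^+ k)); last first.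
  by move=> k _; ring.
by apply => k _; rewrite mulr_ge0// exprn_ge0// ltW.
Qed.

Lemma dimer_density_continuous (t : R) : 0 <= t -> {for t, continuous rho}.
Proof.
move=> t0; rewrite (_ : rho = fun x => ('X * P^`()).[x] / (n%:R * P.[x])); last first.
  by apply/funext => x; rewrite dimer_density_horner.
have [n0|n0] := posnP n.
  rewrite (_ : (fun x => _) = cst 0); first exact: cst_continuous.
  by apply/funext => x; rewrite n0 mul0r invr0 mulr0.
apply: (@continuousM _ _ (horner ('X * P^`())) (fun x => (n%:R * P.[x])^-1)).
  exact: continuous_horner.
apply: continuousV.
  by rewrite mulf_neq0 ?pnatr_eq0 ?gt_eqF// -matching_gf_horner matching_gf_gt0.
apply: (@continuousM _ _ (cst n%:R) (horner P)); first exact: cst_continuous.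
exact: continuous_horner.
Qed.

Lemma dimer_density0 : rho 0 = 0.
Proof. by rewrite /dimer_density !mul0r. Qed.

Lemma dimer_density_homo : {in Num.nneg &, {homo rho : s t / s <= t}}.
Proof.
move=> s t; rewrite !nnegrE => s0 t0 st.
apply: (@ger0_derive1_ndecr _ rho s t) => //.
- move=> x; rewrite in_itv/= => /andP[/(le_lt_trans s0) x0 _].
  by have [D [dr _] _] := is_derive_dimer_density x0.
- move=> x; rewrite in_itv/= => /andP[/(le_lt_trans s0) x0 _].
  by have [D [dr DE] D0] := is_derive_dimer_density x0; rewrite derive1E DE.
- apply: continuous_in_subspaceT => x; rewrite inE/= in_itv/= => /andP[sx _].
  exact/dimer_density_continuous/(le_trans s0).
Qed.

(* [dimer_density] is only known to be weakly monotone; when the densities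
   coincide, so do the activities, since [activity] is a function. *)
Lemma activity_homo p q : 0 <= activity e p -> 0 <= activity e q ->
  rho (activity e p) = p -> rho (activity e q) = q ->
  p <= q -> activity e p <= activity e q.
Proof.
move=> p0 q0 ep eq pq; rewrite leNgt; apply/negP => qp.
have : q <= p by rewrite -ep -eq dimer_density_homo ?nnegrE// ltW.
by move=> qp'; have E : p = q by [apply/le_anti; rewrite pq]; rewrite E ltxx in qp.
Qed.

Lemma activityP p t : 0 <= t -> rho t = p ->
  0 <= activity e p /\ rho (activity e p) = p.
Proof. move=> t0 tp.
by apply: (@xgetPex _ 0 [set t | 0 <= t /\ rho t = p]%classic); exists t. Qed.

(** This is [entropy_at] without its case distinction at [0], ready for differentiation at
    [t > 0]. *)
Definition entropy_formula (t : R) : R :=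
  ln (M t) / #|T|%:R - 2^-1 * rho t * ln t.

(** As [#|T| = 2 n], the derivative of [ln M / #|T|] is [rho / (2 * t)], which cancels the term
    coming from the derivative of [ln t]. *)
Lemma is_derive_entropy_formula (t D : R) : #|T| = n.*2 -> 0 < t ->
  is_derive t 1 rho D -> is_derive t 1 entropy_formula (- (2^-1 * D * ln t)).
Proof.
move=> Tn t0 hD.
have Mt : 0 < M t by rewrite matching_gf_gt0// ltW.
have hM := is_derive_ln_comp Mt (is_derive_matching_gf t).
have hl := is_derive1_ln t0.
rewrite /entropy_formula; apply: is_derive_eq; rewrite /= /GRing.scale/=.
have [n0|n0] := posnP n.
  by rewrite Tn dimer_density_nil// n0 invr0; ring.
rewrite dimer_density_horner -matching_gf_horner hornerM hornerX.
set m := #|T|./2 in Tn n0 *; rewrite Tn -muln2 natrM.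
field; rewrite !gt_eqF ?ltr0n//.
Qed.
End DimerDensity.

(** * Range of the density in vertex-transitive bipartite graphs *)

Section RegularDensity.
Variables (R : realType) (T : finType) (e : rel T) (d : nat).
Hypothesis d_gt0 : (0 < d)%N.
Hypothesis T_gt0 : (0 < #|T|)%N.
Hypothesis e_simple : simple_graph e.
Hypothesis e_reg : regular_graph e d.
Hypothesis e_vt : vertex_transitive e.
Hypothesis e_bip : bipartite_graph e.

Local Notation rho := (@dimer_density R T e).
Local Notation Z W t := (@matching_sum R T e W t).
Local Notation n := (#|T|./2).

Let T_even : #|T| = n.*2.
Proof. exact: card_bipartite_regular d_gt0 e_simple e_reg e_bip. Qed.

Let n_gt0 : (0 < n)%N.
Proof. by move: T_gt0; rewrite {1}T_even double_gt0. Qed.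

(** The product [t * M'(t)] is the sum of [#|M| * t ^ #|M|], which [sum_card_matching_rem] expresses
    through one vertex. This turns the bounds on [p] into bounds on [rho t]. *)
Lemma dimer_density_vertex (t : R) u : 0 <= t ->
  rho t = 1 - Z [set~ u]%SET t / Z [set: T]%SET t.
Proof.
move=> t0.
have ME : matching_gf e t = Z [set: T]%SET t.
  by rewrite matching_sumTE (sum_matching_card e_simple (fun k => t ^+ k)).
have Z0 : 0 < Z [set: T]%SET t by exact: matching_sum_gt0.
rewrite dimer_density_horner -matching_gf_horner ME mulX_deriv_poly horner_poly.
have -> : \sum_(k < n.+1) k%:R * (matchings_count e k)%:R * t ^+ k =
    n%:R * (Z [set: T]%SET t - Z [set~ u]%SET t).
  apply: (@mulfI _ 2) => //.
  rewrite mulrA -natrM mul2n -T_even (sum_card_matching_rem t e_simple e_vt).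
  rewrite (sum_matching_card e_simple (fun k => k%:R * t ^+ k)).
  by congr (_ * _); apply: eq_bigr => k _; ring.
by field; rewrite !gt_eqF// ltr0n.
Qed.

Let u0 : T. Proof. by have /card_gt0P/sigW[x _] := T_gt0. Qed.

Lemma dimer_density_lt1 (t : R) : 0 <= t -> rho t < 1.
Proof.
by move=> t0; rewrite (dimer_density_vertex u0 t0); exact: density_lt1.
Qed.

Lemma dimer_density_ineq (t : R) : 0 <= t ->
  d%:R * t * (1 - rho t) ^+ 2 <= rho t * (1 - rho t / d%:R).
Proof.
have [A eA] := e_bip.
move=> t0; rewrite (dimer_density_vertex u0 t0).
exact: (density_ineq d_gt0 e_simple e_reg t0 e_vt eA).
Qed.

Lemma dimer_density_cycle_ineq (t : R) l : 0 <= t -> has_cycle e l ->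
  d%:R * t * (1 - rho t) ^+ 2 <= rho t * (1 - rho t / d%:R)
    - 2 * gap_rate d (rho t) ^+ l.
Proof.
have [A eA] := e_bip.
move=> t0 hl; apply: (cycle_density_ineq d_gt0 e_simple e_reg t0 e_vt eA hl).
exact: (dimer_density_vertex u0 t0).
Qed.

Lemma dimer_density_gt0 (t : R) : 0 < t -> 0 < rho t.
Proof.
move=> t0; have [/ltW t0' rt1] := (t0, dimer_density_lt1 (ltW t0)).
rewrite lt_neqAle -{2}(dimer_density0 R e) dimer_density_homo ?nnegrE// andbT.
(* A zero density would turn [dimer_density_ineq] into [d * t <= 0]. *)
apply/eqP => /esym r0; have := dimer_density_ineq t0'.
by rewrite r0 subr0 expr1n mulr1 mul0r leNgt mulr_gt0 ?ltr0n.
Qed.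

(** The right-hand side of [dimer_density_ineq] is at most [1], so [(1 - rho t) ^ 2 <= 1 / (d * t)];
    the witness [t] makes this bound equal to [(1 - q) ^ 2]. *)
Lemma dimer_density_big (q : R) : 0 <= q -> q < 1 ->
  exists2 t, 0 <= t & q <= rho t.
Proof.
move=> q0 q1; have d0 : 0 < d%:R :> R by rewrite ltr0n.
pose t := (d%:R * (1 - q) ^+ 2)^-1.
have t0 : 0 < t by rewrite invr_gt0 mulr_gt0// exprn_gt0// subr_gt0.
exists t; first exact: ltW.
have r0 := dimer_density_gt0 t0; have r1 := dimer_density_lt1 (ltW t0).
have : d%:R * t * (1 - rho t) ^+ 2 <= 1.
  apply: le_trans (dimer_density_ineq (ltW t0)) _.
  apply: mulr_ile1; [exact: ltW| |exact: ltW|].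
    by rewrite subr_ge0 ler_pdivrMr// mul1r (le_trans (ltW r1))// ler1n.
  by rewrite gerBl divr_ge0// ltW.
have -> : d%:R * t = ((1 - q) ^+ 2)^-1.
  by rewrite /t invfM mulrA divff ?mul1r// gt_eqF.
rewrite mulrC ler_pdivrMr ?exprn_gt0 ?subr_gt0// mul1r.
by rewrite ler_sqr ?nnegrE ?subr_ge0 ?(ltW r1) ?(ltW q1)// lerD2l lerN2.
Qed.

Lemma dimer_density_onto (p : R) : 0 <= p -> p < 1 ->
  exists2 t, 0 <= t & rho t = p.
Proof.
move=> p0 p1; have [b b0 pb] := dimer_density_big p0 p1.
have [||t] := @IVT _ rho 0 b p b0.
- apply: continuous_in_subspaceT => x; rewrite inE/= in_itv/= => /andP[x0 _].
  exact: dimer_density_continuous.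
- rewrite dimer_density0 ge_min p0/= le_max pb orbT//.
- by rewrite in_itv/= => /andP[t0 _] tp; exists t.
Qed.

Lemma activity_onto (p : R) : 0 <= p -> p < 1 ->
  0 <= activity e p /\ rho (activity e p) = p.
Proof. by move=> p0 p1; have [t t0 /activityP] := dimer_density_onto p0 p1; apply. Qed.

(** The density is an average of [2 * #|M| / #|T|], hence at most [max_density], and by
    [dimer_density_big] it comes arbitrarily close to [1]. *)
Lemma max_density_regular : max_density R e = 1.
Proof.
have N0 : 0 < #|T|%:R :> R by rewrite ltr0n.
apply/le_anti/andP; split.
  rewrite ler_pdivrMr// mul1r ler_nat /matching_number.
  rewrite mulnC -leq_divRL//; apply/bigmax_leqP => M mM.
  by rewrite leq_divRL// mulnC (card_matching e_simple).
rewrite leNgt; apply/negP => m1.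
have m0 : 0 <= max_density R e by rewrite divr_ge0.
pose q := (max_density R e + 1) / 2.
have [||t t0 qt] := @dimer_density_big q; rewrite /q; [lra|lra|].
suff : rho t <= max_density R e by move: qt; rewrite /q; lra.
rewrite (dimer_density_vertex u0 t0).
have Z0 : 0 < Z [set: T]%SET t by exact: matching_sum_gt0.
rewrite -[1](divff (lt0r_neq0 Z0)) -mulrBl ler_pdivrMr//.
rewrite /max_density mulrAC ler_pdivlMr//.
rewrite mulrC (sum_card_matching_rem t e_simple e_vt) natrM -mulrA ler_wpM2l//.
rewrite matching_sumTE mulr_sumr; apply: ler_sum => M mM.
by rewrite ler_wpM2r ?exprn_ge0// ler_nat leq_bigmax_cond.
Qed.

End RegularDensity.

(** * The gap function *)

(** With [s = sqrt y], the bound [ln (1 / s) < 1 / s] gives [|y * ln y| <= 2 * s] for [0 < y < 1].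
    For [y <= 0] the default [ln y = 0] makes the limit two-sided. *)
Lemma cvg_xlnx0 (R : realType) :
  ((fun y : R => y * ln y) y @[y --> (0 : R)] --> (0 : R))%classic.
Proof.
have c : ((fun y : R => 2 * Num.sqrt y) y @[y --> (0 : R)] --> (0 : R))%classic.
  have := cvgM (cvg_cst (2 : R)) (@sqrt_continuous R 0).
  by rewrite sqrtr0 mulr0; apply.
apply: (@squeeze_cvgr _ _ _ _ (fun y => - (2 * Num.sqrt y)) (fun y => 2 * Num.sqrt y)).
- near=> y; have y1 : y < 1 by near: y; exact: lt_nbhsl.
  rewrite -ler_norml; have [y0|y0] := leP y 0.
    by rewrite ln0// mulr0 normr0 mulr_ge0// sqrtr_ge0.
  have s0 : 0 < Num.sqrt y by rewrite sqrtr_gt0.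
  rewrite -{1 2}(sqr_sqrtr (ltW y0)) lnXn// normrM ger0_norm ?sqr_ge0//.
  rewrite ler0_norm; last by rewrite mulrn_wle0// ln_le0// -sqrtr1 ler_sqrt// ltW.
  rewrite -mulNrn -lnV// -[_ *+ 2]mulr_natl.
  have := ln_sublinear (_ : 0 < (Num.sqrt y)^-1); rewrite invr_gt0 => /(_ s0)/ltW h.
  rewrite mulrCA ler_wpM2l// expr2 -mulrA ler_piMr ?(ltW s0)//.
  by rewrite -ler_pdivlMl// mulr1.
- by rewrite -[X in (_ --> X)%classic]oppr0; exact: cvgN.
- exact: c.
Unshelve. all: by end_near. Qed.

Lemma continuous_xlnx (R : realType) (x : R) : 0 <= x ->
  {for x, continuous (fun y : R => y * ln y)}.
Proof.
rewrite le_eqVlt => /orP[/eqP x0|x0]; last first.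
  by apply: (@continuousM _ _ id (@ln R)) => //; exact: continuous_ln.
by rewrite /prop_for /continuous_at -x0 mul0r; exact: cvg_xlnx0.
Qed.

(** Only the function [y * ln y] occurs here; its continuity at [0] gives that of [Gd] at both
    endpoints. *)
Lemma Gd_xlnx (R : realType) (d : nat) : (0 < d)%N ->
  @Gd R d = fun p => 2^-1 * (d%:R * ((1 - p / d%:R) * ln (1 - p / d%:R))
    - d%:R * (p / d%:R * ln (p / d%:R)) - 2 * ((1 - p) * ln (1 - p))).
Proof.
move=> d0; apply/funext => p; rewrite /Gd.
have dn0 : d%:R != 0 :> R by rewrite pnatr_eq0 -lt0n.
have -> : ln (d%:R / p) = - ln (p / d%:R).
  have [p0|p0] := ltP 0 p; first by rewrite -invf_div lnV// posrE divr_gt0// ltr0n.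
  have dp : d%:R / p <= 0 by rewrite mulr_ge0_le0// invr_le0.
  have pd : p / d%:R <= 0 by rewrite mulr_le0_ge0// invr_ge0.
  by rewrite (ln0 dp) (ln0 pd) oppr0.
by field.
Qed.

Lemma continuous_Gd (R : realType) (d : nat) (p : R) : (0 < d)%N -> 0 <= p <= 1 ->
  {for p, continuous (@Gd R d)}.
Proof.
move=> d0 /andP[p0 p1]; rewrite Gd_xlnx//.
have d1 : 1 <= d%:R :> R by rewrite ler1n.
pose h (y : R) := y * ln y.
have c1 : {for p, continuous (fun q : R => q / d%:R)}.
  by apply: (@continuousM _ _ id (cst d%:R^-1)) => //; exact: cst_continuous.
have c2 : {for p, continuous (fun q : R => 1 - q / d%:R)}.
  by apply: cvgB; [exact: cvg_cst|exact: c1].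
have c3 : {for p, continuous (fun q : R => 1 - q)}.
  by apply: cvgB; [exact: cvg_cst|exact: cvg_id].
have h1 : {for p, continuous (fun q : R => h (q / d%:R))}.
  by apply: (continuous_comp c1); apply: continuous_xlnx; rewrite divr_ge0.
have h2 : {for p, continuous (fun q : R => h (1 - q / d%:R))}.
  apply: (continuous_comp c2); apply: continuous_xlnx.
  by rewrite subr_ge0 ler_pdivrMr ?mul1r; lra.
have h3 : {for p, continuous (fun q : R => h (1 - q))}.
  by apply: (continuous_comp c3); apply: continuous_xlnx; rewrite subr_ge0.
by apply: cvgM; [exact: cvg_cst|]; apply: cvgB; [apply: cvgB|];
  apply: cvgM; by [exact: cvg_cst|exact: h2|exact: h1|exact: h3].
Qed.

Lemma Gd0 (R : realType) (d : nat) : Gd d (0 : R) = 0.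
Proof. by rewrite /Gd !(mul0r, subr0, ln1, mulr0, addr0). Qed.

(* The right-hand side is the derivative of the gap at density [p]: the
   derivative of the entropy is [- ln t / 2]. *)
Lemma ln_activity_excess (R : realType) (d t p x : R) :
  1 <= d -> 0 < t -> 0 < p < 1 -> 0 <= x ->
  d * t * (1 - p) ^+ 2 <= p * (1 - p / d) - 2 * x ->
  x <= - (2^-1 * ln t)
       - 2^-1 * (ln (d / p) - ln (1 - p / d) + 2 * ln (1 - p)).
Proof.
move=> d1 t0 /andP[p0 p1] x0 h.
have d0 : 0 < d by lra.
have dp : 0 < d / p by rewrite divr_gt0.
have pd : 0 < 1 - p / d by rewrite subr_gt0 ltr_pdivrMr; lra.
have p1' : 0 < 1 - p by lra.
pose y := p * (1 - p / d).
have y0 : 0 < y by rewrite mulr_gt0.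
have y1 : y <= 1.
  by apply: mulr_ile1; rewrite ?(ltW p0) ?(ltW p1) ?(ltW pd)// gerBl divr_ge0// ltW.
(* The ratio of [t] to the activity [t_d] of [Gd]; the right-hand side of the goal is
   [- ln r / 2]. *)
pose r := t * (d / p) / (1 - p / d) * (1 - p) ^+ 2.
have r0 : 0 < r by rewrite !mulr_gt0 ?invr_gt0 ?exprn_gt0.
have lnr : ln r = ln t + ln (d / p) - ln (1 - p / d) + 2 * ln (1 - p).
  have tdp : 0 < t * (d / p) by rewrite mulr_gt0.
  rewrite /r (@lnM _ (_ / _)) ?posrE ?exprn_gt0 ?(divr_gt0 tdp)// lnXn//.
  by rewrite (ln_div tdp pd) (lnM t0 dp) mulr_natl.
have rE : r * y = d * t * (1 - p) ^+ 2.
  by rewrite /r /y; field; rewrite !gt_eqF//= ; lra.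
(* As [y <= 1], the hypothesis gives [r * y <= y - 2 * x <= (1 - 2 * x) * y]. Then
   [ln r <= r - 1 <= - 2 * x]. *)
have rx : r <= 1 - 2 * x.
  rewrite -(ler_pM2r y0) rE; apply: le_trans h _; rewrite -/y.
  nra.
have : ln r <= r - 1.
  by have := @le_ln1Dx _ (r - 1); rewrite [1 + _]addrC subrK; apply; lra.
by rewrite lnr; lra.
Qed.

Section Gap.
Variables (R : realType) (T : finType) (e : rel T) (d : nat).
Hypothesis d_gt0 : (0 < d)%N.
Hypothesis T_gt0 : (0 < #|T|)%N.
Hypothesis e_simple : simple_graph e.
Hypothesis e_reg : regular_graph e d.
Hypothesis e_vt : vertex_transitive e.
Hypothesis e_bip : bipartite_graph e.

Local Notation rho := (@dimer_density R T e).
Local Notation F := (@entropy_formula R T e).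
Local Notation act := (@activity R T e).

Let T_even : #|T| = (#|T|./2).*2.
Proof. exact: card_bipartite_regular d_gt0 e_simple e_reg e_bip. Qed.
Let rho_gt0 (t : R) : 0 < t -> 0 < rho t.
Proof. exact: (dimer_density_gt0 d_gt0 T_gt0 e_simple e_reg e_vt e_bip). Qed.
Let rho_lt1 (t : R) : 0 <= t -> rho t < 1.
Proof. exact: (dimer_density_lt1 d_gt0 T_gt0 e_simple e_reg e_vt e_bip). Qed.
Let actP (p : R) : 0 <= p -> p < 1 -> 0 <= act p /\ rho (act p) = p.
Proof. exact: (activity_onto d_gt0 T_gt0 e_simple e_reg e_vt e_bip). Qed.

Lemma activity_gt0 (p : R) : 0 < p < 1 -> 0 < act p.
Proof.
move=> /andP[p0 p1]; have [a0 ap] := actP (ltW p0) p1.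
rewrite lt_neqAle a0 andbT; apply/eqP => a00.
by move: ap; rewrite -a00 dimer_density0 => p0'; rewrite -p0' ltxx in p0.
Qed.

Lemma activity0 : act 0 = 0.
Proof.
have [a0 ap] := actP (lexx 0) ltr01.
apply/eqP; rewrite eq_le a0 andbT leNgt; apply/negP => /rho_gt0.
by rewrite ap ltxx.
Qed.

Lemma entropyE (p : R) : 0 < p < 1 -> entropy e p = F (act p).
Proof.
move=> p01; have /andP[p0 p1] := p01; rewrite /entropy.
rewrite (max_density_regular R d_gt0 T_gt0 e_simple e_reg e_vt e_bip) p1.
by rewrite /entropy_at gt_eqF// activity_gt0.
Qed.

Lemma gap0 : gap e d (0 : R) = 0.
Proof.
rewrite /gap /entropy (max_density_regular R d_gt0 T_gt0 e_simple e_reg e_vt e_bip).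
by rewrite ltr01 activity0 /entropy_at eqxx Gd0 subrr.
Qed.

(** * Comparison of the gap with a primitive *)

Section Comparison.
Variables (Phi phi : R -> R).
Hypothesis Phi_derive : forall p : R, 0 < p < 1 -> is_derive p 1 Phi (phi p).
Hypothesis phi_ge0 : forall p : R, 0 < p < 1 -> 0 <= phi p.
Hypothesis phi_excess : forall t : R, 0 < t ->
  d%:R * t * (1 - rho t) ^+ 2 <= rho t * (1 - rho t / d%:R) - 2 * phi (rho t).
Hypothesis Phi_cvg0 : (Phi x @[x --> (0 : R)] --> (0 : R))%classic.
Hypothesis Phi0 : Phi 0 = 0.

(** The difference of the gap and [Phi] in the variable [t], where monotonicity is proved without
    differentiating [activity]. *)
Let K (t : R) := F t - Gd d (rho t) - Phi (rho t).

Let K_derive (t : R) : 0 < t -> exists2 D, is_derive t 1 K D & 0 <= D.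
Proof.
move=> t0; have [D hD D0] := @is_derive_dimer_density R T e t t0.
have p01 : 0 < rho t < 1 by rewrite rho_gt0// rho_lt1// ltW.
have hF := is_derive_entropy_formula T_even t0 hD.
have hG := is_derive1_comp (is_derive_Gd d_gt0 p01) hD.
have hP := is_derive1_comp (Phi_derive p01) hD.
have dF := is_deriveB (is_deriveB hF hG) hP.
eexists; first exact: dF.
have d1 : 1 <= d%:R :> R by rewrite ler1n.
have := ln_activity_excess d1 t0 p01 (phi_ge0 p01) (phi_excess t0).
rewrite -subr_ge0 => /(mulr_ge0 D0) h; apply: le_trans h _.
by rewrite le_eqVlt; apply/orP; left; apply/eqP; ring.
Qed.

Let K_homo (s t : R) : 0 < s -> s <= t -> K s <= K t.
Proof.
move=> s0 st; apply: (@ger0_derive1_ndecr _ K s t) => //.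
- move=> x; rewrite in_itv/= => /andP[/(lt_trans s0) x0 _].
  by have [D [dr _] _] := K_derive x0.
- move=> x; rewrite in_itv/= => /andP[/(lt_trans s0) x0 _].
  by have [D [dr DE] D0] := K_derive x0; rewrite derive1E DE.
- apply: derivable_within_continuous => x.
  rewrite in_itv/= => /andP[/(lt_le_trans s0) x0 _].
  by have [D [dr _] _] := K_derive x0.
Qed.

(** For [s <= 1] one has [ln s <= 0], so [F s >= 0] and [K s >= - Gd (rho s) - Phi (rho s)], which
    tends to [0] with [s]; monotonicity carries the bound to [t]. *)
Let K_ge0 (t : R) : 0 < t -> 0 <= K t.
Proof.
move=> t0.
have rho0 : (rho s @[s --> (0 : R)] --> (0 : R))%classic.
  by have := @dimer_density_continuous R T e 0 (lexx 0);
    rewrite /prop_for /continuous_at dimer_density0.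
have G0 : (Gd d p @[p --> (0 : R)] --> (0 : R))%classic.
  have := @continuous_Gd R d 0 d_gt0.
  by rewrite /prop_for /continuous_at Gd0 lexx ler01 => /(_ isT).
have c : ((fun s => - Gd d (rho s) - Phi (rho s)) s @[s --> (0 : R)^'+]
    --> (0 : R))%classic.
  apply: cvg_at_right_filter.
  have := cvgB (cvgN (cvg_comp _ _ rho0 G0)) (cvg_comp _ _ rho0 Phi_cvg0).
  by rewrite oppr0 addr0; apply.
apply: (cvgr_to_le c); near=> s.
have s0 : 0 < s by [].
have s1 : s <= 1 by near: s; exact: nbhs_right_le.
have st : s <= t by near: s; exact: nbhs_right_le.
apply: le_trans (K_homo s0 st).
rewrite /K -addrA -[leLHS]add0r lerD2r /entropy_formula subr_ge0.
apply: (@le_trans _ _ 0).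
  rewrite mulr_ge0_le0 ?ln_le0// mulr_ge0 ?invr_ge0// ltW// rho_gt0//.
by rewrite divr_ge0// ln_ge0// matching_gf_ge1// ltW.
Unshelve. all: by end_near. Qed.

(** Used with [Phi = 0] for monotonicity and with the integral of [gap_rate d x ^ l] for the cycle
    bound. *)
Lemma gap_sub_homo :
  {in `[0, 1[ &, {homo (fun p : R => gap e d p - Phi p) : p q / p <= q}}.
Proof.
have gE p : 0 < p < 1 -> gap e d p - Phi p = K (act p).
  move=> p01; have /andP[/ltW p0 p1] := p01.
  by rewrite /gap entropyE// /K (actP p0 p1).2.
move=> p q; rewrite !in_itv/= => /andP[p0 p1] /andP[q0 q1] pq.
(* At [p = 0] the activity is [0], where [K_homo] does not apply; [K_ge0] replaces it. *)
have [p00|p_gt0] := eqVneq p 0.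
  rewrite p00 gap0 Phi0 subrr.
  have [->|q_gt0] := eqVneq q 0; first by rewrite gap0 Phi0 subrr.
  have q01 : 0 < q < 1 by rewrite lt0r q_gt0 q0.
  by rewrite gE// K_ge0// activity_gt0.
have p01 : 0 < p < 1 by rewrite lt0r p_gt0 p0.
have q01 : 0 < q < 1 by rewrite q1 andbT (lt_le_trans _ pq)//; case/andP: p01.
rewrite !gE// K_homo ?activity_gt0//.
have [[ap hp] [aq hq]] := (actP p0 p1, actP q0 q1).
exact: activity_homo.
Qed.

End Comparison.

Lemma gap_homo_lt1 : {in `[0, 1[ &, {homo @gap R T e d : p q / p <= q}}.
Proof.
have h := @gap_sub_homo (fun=> 0) (fun=> 0).
move=> p q hp hq pq; rewrite -[leLHS]subr0 -[leRHS]subr0; apply: h => //.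
- move=> t /ltW t0; rewrite mulr0 subr0.
  exact: (dimer_density_ineq d_gt0 T_gt0 e_simple e_reg e_vt e_bip).
- exact: cvg_cst.
Qed.

(** * Left limit at density one *)

Let Gd_cvg1 : (Gd d p @[p --> (1 : R)^'-] --> Gd d (1 : R))%classic.
Proof.
apply: cvg_at_left_filter; apply: continuous_Gd => //.
by rewrite ler01 lexx.
Qed.

(** The derivative [- D * ln t / 2] is nonpositive from [t = 1] on. This bounds the entropy at
    densities close to [1]. *)
Let F_le1 (t : R) : 1 <= t -> F t <= F 1.
Proof.
move=> t1.
have der (x : R) : 1 <= x -> exists2 D, is_derive x 1 F D & D <= 0.
  move=> x1; have x0 : 0 < x by exact: lt_le_trans x1.
  have [D hD D0] := @is_derive_dimer_density R T e x x0.
  exists (- (2^-1 * D * ln x)); first exact: is_derive_entropy_formula.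
  by rewrite oppr_le0 mulr_ge0 ?ln_ge0// mulr_ge0.
apply: (@ler0_derive1_nincr _ F 1 t) => //.
- move=> x; rewrite in_itv/= => /andP[/ltW x0 _].
  by have [D [dr _] _] := der x x0.
- move=> x; rewrite in_itv/= => /andP[/ltW x0 _].
  by have [D [dr DE] D0] := der x x0; rewrite derive1E DE.
- apply: derivable_within_continuous => x; rewrite in_itv/= => /andP[x0 _].
  by have [D [dr _] _] := der x x0.
Qed.

Let gap_cvg1 : cvg (gap e d p @[p --> (1 : R)^'-])%classic.
Proof.
apply: nondecreasing_at_left_is_cvgr.
- near=> x => p q; rewrite !in_itv/= => /andP[xp p1] /andP[xq q1] pq.
  have x0 : 0 <= x by near: x; exact: nbhs_left_ge.
  by apply: gap_homo_lt1 => //; rewrite in_itv/= ?p1 ?q1 ?(le_trans x0)// ltW.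
(* Close to density [1] the entropy is at most [F 1] and [Gd] is at least [Gd 1 - 1]; monotonicity
   extends the resulting bound to smaller densities. *)
near=> x; exists (F 1 - (Gd d (1 : R) - 1)) => _ [y /= + <-].
rewrite in_itv/= => /andP[xy y1].
have x0 : 0 <= x by near: x; exact: nbhs_left_ge.
near ((1 : R)^'-)%classic => z.
have z1 : z < 1 by [].
have yz : y <= z by near: z; exact: nbhs_left_ge.
have Gz : Gd d (1 : R) - 1 <= Gd d z.
  by near: z; apply: (cvgr_ge _ Gd_cvg1); rewrite ltrBlDr ltrDl ltr01.
(* This forces the activity of [z] to be at least [1], where [F_le1] applies. *)
have rz : rho 1 < z by near: z; apply: nbhs_left_gt; exact: rho_lt1.
have y0 : 0 < y by exact: le_lt_trans xy.
have z0 : 0 < z by exact: lt_le_trans yz.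
apply: (@le_trans _ _ (gap e d z)).
  by apply: gap_homo_lt1 => //; rewrite in_itv/= ?y1 ?z1 ltW.
have z01 : 0 < z < 1 by rewrite z0.
rewrite /gap entropyE// lerB// F_le1// leNgt; apply/negP => a1.
have [a0 az] := actP (ltW z0) z1.
have : rho (act z) <= rho 1 by rewrite dimer_density_homo ?nnegrE// ltW.
by rewrite az leNgt rz.
Unshelve. all: by end_near. Qed.

(** The entropy at [1] is by definition a left limit, which exists by [gap_cvg1] and the continuity
    of [Gd]. *)
Lemma gap_cvg_left1 : (gap e d p @[p --> (1 : R)^'-] --> gap e d (1 : R))%classic.
Proof.
have -> : gap e d (1 : R) = lim (gap e d p @[p --> (1 : R)^'-])%classic.
  rewrite {1}/gap /entropy (max_density_regular R d_gt0 T_gt0 e_simple e_reg e_vt e_bip).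
  rewrite ltxx eqxx; apply/eqP; rewrite subr_eq; apply/eqP.
  apply: cvg_lim => //.
  apply: (@cvg_trans _ (((gap e d \+ @Gd R d) p) @[p --> (1 : R)^'-])%classic).
    apply: near_eq_cvg; near=> p.
    have p01 : 0 < p < 1 by apply/andP; split => //; near: p; exact: nbhs_left_gt.
    by rewrite /= /gap subrK entropyE// /entropy_at gt_eqF// activity_gt0.
  exact: cvgD.
exact: gap_cvg1.
Unshelve. all: by end_near. Qed.

Lemma gap_homo : {in `[0, 1] &, {homo @gap R T e d : p q / p <= q}}.
Proof.
move=> p q; rewrite !in_itv/= => /andP[p0 p1] /andP[q0 q1] pq.
have [q1'|q1'] := ltP q 1.
  by apply: gap_homo_lt1 => //; rewrite in_itv/= ?p0 ?q0//= (le_lt_trans pq).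
have qE : q = 1 by apply/le_anti; rewrite q1.
have [p1'|p1'] := ltP p 1; last first.
  by have -> : p = q by apply/le_anti; rewrite pq qE.
rewrite qE; apply: (cvgr_to_ge gap_cvg_left1); near=> z.
have pz : p <= z by near: z; exact: nbhs_left_ge.
have z1 : z < 1 by [].
by apply: gap_homo_lt1 => //; rewrite in_itv/= ?p0 ?(le_trans p0 pz).
Unshelve. all: by end_near. Qed.

End Gap.

(** * Integral lower bound from a cycle *)

Lemma continuous_gap_rate (R : realType) (d l : nat) :
  continuous (fun x : R => gap_rate d x ^+ l).
Proof.
move=> x; apply: continuous_comp (@exprn_continuous R l _).
apply: cvgM; first exact: cvg_cst.
apply: (@continuous_min _ _ id (fun x : R => (1 - x) ^+ 2)); first exact: cvg_id.
apply: continuous_comp (@exprn_continuous R 2 _).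
by apply: cvgB; [exact: cvg_cst|exact: cvg_id].
Qed.

Lemma gap_rate_ge0 (R : realType) (d : nat) (x : R) : 0 <= x -> 0 <= gap_rate d x.
Proof. by move=> x0; rewrite mulr_ge0// le_min x0 sqr_ge0. Qed.

Section CycleGap.
Variables (R : realType) (T : finType) (e : rel T) (d l : nat).
Hypothesis d_gt0 : (0 < d)%N.
Hypothesis T_gt0 : (0 < #|T|)%N.
Hypothesis e_simple : simple_graph e.
Hypothesis e_reg : regular_graph e d.
Hypothesis e_vt : vertex_transitive e.
Hypothesis e_bip : bipartite_graph e.
Hypothesis e_cycle : has_cycle e l.

Let phi (x : R) : R := gap_rate d x ^+ l.
Let Phi (p : R) : R := \int[lebesgue_measure]_(x in `[0, p]) phi x.

Let phi_integrable : lebesgue_measure.-integrable `[(0 : R), 1]%classic (EFin \o phi).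
Proof.
apply: continuous_compact_integrable; first exact: segment_compact.
by apply: continuous_subspaceT; exact: continuous_gap_rate.
Qed.

(** The difference of the gap and [Phi] is non-decreasing and vanishes at [0], which settles
    [p < 1]; at [p = 1] both sides are left limits. *)
Lemma gap_ge_integral : {in `[(0 : R), 1], forall p, Phi p <= gap e d p}.
Proof.
have Phi0 : Phi 0 = 0 by rewrite /Phi set_itv1 Rintegral_set1.
have Phi_derive (p : R) : 0 < p < 1 -> is_derive p 1 Phi (phi p).
  move=> /andP[p0 p1].
  have [||dP PE] := @continuous_FTC1 R phi (BLeft 0) p 1 p1 phi_integrable.
  - exact: p0.
  - exact: continuous_gap_rate.
  - apply: DeriveDef; first exact: dP.
    by rewrite -derive1E; exact: PE.
have homo : {in `[0, 1[ &, {homo (fun p : R => gap e d p - Phi p) : p q / p <= q}}.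
  apply: (gap_sub_homo d_gt0 T_gt0 e_simple e_reg e_vt e_bip Phi_derive) => //.
  - by move=> p /andP[/ltW p0 _]; rewrite exprn_ge0// gap_rate_ge0.
  - move=> t /ltW t0.
    exact: (dimer_density_cycle_ineq d_gt0 T_gt0 e_simple e_reg e_vt e_bip t0 e_cycle).
  - exact: (parameterized_integral_cvg_left ltr01 phi_integrable).
have lt1 (p : R) : 0 <= p -> p < 1 -> Phi p <= gap e d p.
  move=> p0 p1; rewrite -subr_ge0; have := homo 0 p.
  rewrite gap0// Phi0 subrr; apply => //; rewrite in_itv/= ?lexx ?ltr01 ?p0//.
move=> p; rewrite in_itv/= => /andP[p0].
rewrite le_eqVlt => /orP[/eqP->|]; last exact: lt1.
apply: (ler_cvg_to (parameterized_integral_cvg_at_left ltr01 phi_integrable)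
  (gap_cvg_left1 d_gt0 T_gt0 e_simple e_reg e_vt e_bip)).
near=> q; apply: lt1; last by [].
by near: q; exact: nbhs_left_ge.
Unshelve. all: by end_near. Qed.

End CycleGap.

Theorem theorem1p4 (R : realType) (d : nat) (T : finType) (e : rel T)
    (d_ge2 : (2 <= d)%N) (T_gt0 : (0 < #|T|)%N)
    (e_simple : simple_graph e) (e_reg : regular_graph e d)
    (e_vt : vertex_transitive e) (e_bip : bipartite_graph e) :
  [/\ {in `[0 : R, 1] &, {homo gap e d : x y / x <= y}},
      gap e d (0 : R) = 0,
      {in `[0 : R, 1], forall p, 0 <= gap e d p}
    & forall l : nat, has_cycle e l ->
      {in `[0 : R, 1], forall p,
        \int[lebesgue_measure]_(x in `[0, p]) (gap_rate d x ^+ l)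
          <= gap e d p}].
Proof.
have d_gt0 : (0 < d)%N by exact: ltn_trans d_ge2.
have homo := @gap_homo R T e d d_gt0 T_gt0 e_simple e_reg e_vt e_bip.
have g0 := gap0 R d_gt0 T_gt0 e_simple e_reg e_vt e_bip.
split => //.
- move=> p p01; rewrite -g0; apply: homo => //.
    by rewrite in_itv/= lexx ler01.
  by move: p01; rewrite in_itv/= => /andP[].
- by move=> l hl; exact: gap_ge_integral.
Qed.
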